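(* Let $f$ be a Lorentzian polynomial of degree $r$ in $n$ variables with $\mathrm{supp}(f)=J$, and let $\kappa\in\mathbb{Z}_{\ge0}^n$. Then $\mathrm{Ret}_\kappa(f)$ is Lorentzian.
   Context: Let $[n]=\{1,\dots,n\}$, $\Delta_n^r=\{\alpha\in\mathbb{Z}_{\ge0}^n:\alpha_1+\cdots+\alpha_n=r\}$, $\alpha!=\prod_i\alpha_i!$, $w^\alpha=\prod_iw_i^{\alpha_i}$, and order $\mathbb{Z}^n$ coordinatewise. A nonempty $J\subseteq\Delta_n^r$ is M-convex if for all $\alpha,\beta\in J$ and $i$ with $\alpha_i<\beta_i$ there is $j$ with $\alpha_j>\beta_j$ and $\alpha+e_i-e_j,\ \beta-e_i+e_j\in J$. Lorentzian polynomials: for $r=0,1$, every nonzero homogeneous polynomial of degree $r$ in $n$ variables with nonnegative real coefficients is Lorentzian. For $r\ge2$, a homogeneous $f\in\mathbb{R}_{\ge0}[w_1,\dots,w_n]$ of degree $r$ is Lorentzian if $\mathrm{supp}(f)$ is M-convex and, for every $\beta\in\Delta_n^{r-2}$, the Hessian matrix of $\partial^\beta f$ has at most one positive eigenvalue. Here $\mathrm{supp}(f)$ is the set of exponents with nonzero coefficient. $\mathrm{proj}_\kappa(v)_i=\min(v_i,\kappa_i)$. $J^{\max_\kappa}$ is the set of $\alpha\in J$ such that $\mathrm{proj}_\kappa(\alpha)$ is coordinatewise maximal in $\mathrm{proj}_\kappa(J)$, and $\mathrm{Ret}_\kappa(J)=\mathrm{proj}_\kappa(J^{\max_\kappa})$.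 A vector $\tau$ is section-defining if $\tau=\alpha-\mathrm{proj}_\kappa(\alpha)$ for some $\alpha\in J^{\max_\kappa}$; then $x+\tau\in J^{\max_\kappa}$ and $\mathrm{proj}_\kappa(x+\tau)=x$ for every $x\in\mathrm{Ret}_\kappa(J)$. Write $f=\sum_{\alpha\in J}c_\alpha\frac{w^\alpha}{\alpha!}$. For section-defining $\tau$ put $\mathrm{Ret}_\kappa^\tau(f)=\sum_{x\in\mathrm{Ret}_\kappa(J)}c_{x+\tau}\frac{w^x}{x!}$. Define $\mathrm{Ret}_\kappa(f)=\sum_\tau\mathrm{Ret}_\kappa^\tau(f)$, the sum over all (distinct) section-defining vectors $\tau$; equivalently $\mathrm{Ret}_\kappa(f)=\sum_{\alpha\in J^{\max_\kappa}}c_\alpha\frac{w^{\mathrm{proj}_\kappa(\alpha)}}{\mathrm{proj}_\kappa(\alpha)!}$. *)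

(* Defs.v *)
From mathcomp Require Import all_boot all_order all_algebra.
From mathcomp Require Import finmap mpoly reals.

Set Implicit Arguments.
Unset Strict Implicit.
Unset Printing Implicit Defensive.

Import Order.TTheory GRing.Theory Num.Theory.

Local Open Scope fset_scope.
Local Open Scope ring_scope.

(* Exponent vectors in Z_{>=0}^n are multinomials ['X_{1..n}], with indices in
   ['I_n = {0, .., n-1}]. [mdeg a] is a_1 + ... + a_n, and [(a <= b)%MM] is the
   coordinatewise order (not [(a <= b)%O], which is a monomial order). *)

Section Sets.
Variable n : nat.
Implicit Types (a b k t x : 'X_{1..n}) (J P : {fset 'X_{1..n}}).

(* In both exchanges the subtracted coordinate is positive, so the truncated
   subtraction of multinomials is the exact one. *)
Definition M_convex (r : nat) J : Prop :=
  [/\ J != fset0,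
      forall a, a \in J -> mdeg a = r
    & forall a b i, a \in J -> b \in J -> (a i < b i)%N ->
        exists j, [/\ (b j < a j)%N,
                      (a + U_(i) - U_(j))%MM \in J
                    & (b - U_(i) + U_(j))%MM \in J]].

Definition proj k a : 'X_{1..n} := [multinom minn (a i) (k i) | i < n].

Definition maximal_elts P : {fset 'X_{1..n}} :=
  [fset x in P | [forall y : P, (x <= val y)%MM ==> (val y == x)]].

Definition max_part k J : {fset 'X_{1..n}} :=
  [fset a in J | proj k a \in maximal_elts (proj k @` J)].

Definition ret_set k J : {fset 'X_{1..n}} := proj k @` max_part k J.

(* [proj k a <= a] coordinatewise, so this subtraction is exact. *)
Definition section_vectors k J : {fset 'X_{1..n}} :=
  [fset (a - proj k a)%MM | a in max_part k J].

End Sets.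

Section Polynomials.
Variables (R : realType) (n : nat).
Implicit Types (f q : {mpoly R[n]}) (k t : 'X_{1..n}).

Definition supp f : {fset 'X_{1..n}} := [fset a in msupp f].

(* The second derivatives of a quadratic form are constant polynomials; the
   Hessian is the real matrix of these constants. *)
Definition hessian q : 'M[R]_n := \matrix_(i, j) (q^`M(j)^`M(i))@_0%MM.

(* Eigenvalues are counted with algebraic multiplicity. *)
Definition at_most_one_pos_eigenvalue (A : 'M[R]_n) : Prop :=
  forall s : seq R, uniq s ->
    (forall l, l \in s -> 0 < l /\ eigenvalue A l) ->
    (\sum_(l <- s) mup l (char_poly A) <= 1)%N.

Definition lorentzian_deg (r : nat) f : Prop :=
  [/\ f \is r.-homog,
      forall a, 0 <= f@_a,
      (r < 2)%N -> f != 0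
    & (2 <= r)%N ->
      M_convex r (supp f) /\
      forall b : 'X_{1..n}, mdeg b = (r - 2)%N ->
        at_most_one_pos_eigenvalue (hessian f^`M[b])].

Definition lorentzian f : Prop := exists r, lorentzian_deg r f.

Definition mfact (a : 'X_{1..n}) : nat := (\prod_(i < n) (a i)`!)%N.

(* The coefficient c_a in f = \sum_a c_a w^a / a!. *)
Definition ncoeff f (a : 'X_{1..n}) : R := (mfact a)%:R * f@_a.

Definition ret_section k t f : {mpoly R[n]} :=
  \sum_(x <- ret_set k (supp f))
    (ncoeff f (x + t)%MM / (mfact x)%:R) *: 'X_[x].

Definition ret k f : {mpoly R[n]} :=
  \sum_(t <- section_vectors k (supp f)) ret_section k t f.

End Polynomials.

(* Main.v *)
Require Import Defs.
From mathcomp Require Import all_boot all_order all_algebra.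
From mathcomp Require Import finmap mpoly reals.
From mathcomp Require Import spectral complex zify ring.

(** Write [J] for the support of [f], [c] for its normalized coefficients and
    [p] for [proj kappa].  Every [a] in [max_part kappa J] is split as
    [p a + (a - p a)].

    Combinatorics.  Exchanges inside [J] show that the maximal elements of
    [p J] all have the same degree, hence that an exchange between two elements
    of [max_part], at a coordinate where their projections differ, stays in
    [max_part], changes the projections by the same step and leaves the section
    vectors alone ([max_part_exchange]).  Two consequences: [ret_set] is
    M-convex, and [max_part] is the full product of [ret_set] by
    [section_vectors] ([max_part_product]).

    Rank one.  On this product [c (x + t)] has rank one, so all the polynomials
    [ret_section] are proportional and [ret] is a positive multiple of any one
    of them ([ncoeff_ret_section]).  It is enough that the minors at neighbours
    [x, x + e_i - e_j] and [t, t + e_p - e_q] vanish, because both factors are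
    connected under such steps.  These four coefficients form an off-diagonal
    2x2 block of the Hessian of one derivative [f^`M[b]], and the diagonal block
    at [i, j] vanishes, since raising an element of [ret_set] in a coordinate
    that is not saturated leaves [J] ([ret_set_raise]).  A quadratic form with a
    totally isotropic plane paired nondegenerately with another plane has two
    positive directions, so the minor is zero ([no_positive_plane_isotropic],
    [adjacent_minor]).

    Truncation.  A single [ret_section] at [t] is the derivative of [f] along
    [t] restricted to exponents below [kappa].  On Hessians this restriction
    deletes rows and columns and replaces some nonnegative diagonal entries by
    zero; neither operation creates a positive direction
    ([no_positive_plane_truncate]).

    The eigenvalue condition is turned into a statement on the quadratic form
    by the spectral theorem: at most one positive eigenvalue means that no two
    vectors orthogonal for the form are both positive
    ([at_most_one_pos_eigenvalueP]). *)

Set Implicit Arguments.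
Unset Strict Implicit.
Unset Printing Implicit Defensive.

Import Order.TTheory GRing.Theory Num.Theory.

Local Open Scope fset_scope.
Local Open Scope ring_scope.

(** * Hermitian forms without positive planes *)

Section HermitianForm.
Local Open Scope sesquilinear_scope.
Variables (C : numClosedFieldType) (n : nat).
Implicit Types (A B : 'M[C]_n) (x y z : 'rV[C]_n).

Definition hform A x y : C := (x *m A *m y ^t*) 0 0.

(** For Hermitian [A], no plane on which the form is positive definite: by
    Gram-Schmidt such a plane has a basis orthogonal for the form. *)
Definition no_positive_plane A : Prop :=
  forall x y, hform A x y = 0 -> 0 < hform A x x -> 0 < hform A y y -> False.

Lemma hformE A x y : hform A x y = \sum_i \sum_j x 0 i * A i j * (y 0 j)^*.
Proof.
rewrite /hform !mxE exchange_big; apply: eq_bigr => j _.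
by rewrite !mxE mulr_suml.
Qed.

Lemma hformDl A x y z a b :
  hform A (a *: x + b *: y) z = a * hform A x z + b * hform A y z.
Proof. by rewrite /hform !mulmxDl -!scalemxAl !mxE. Qed.

Lemma hformC A x y : A ^t* = A -> hform A y x = (hform A x y)^*.
Proof.
move=> hA; rewrite !hformE rmorph_sum exchange_big; apply: eq_bigr => i _.
rewrite rmorph_sum; apply: eq_bigr => j _.
have -> : A j i = (A i j)^* by rewrite -{1}hA !mxE.
by rewrite !rmorphM /= conjCK mulrC [y 0 j * _]mulrC mulrA.
Qed.

Lemma hformDr A x y z a b : A ^t* = A ->
  hform A z (a *: x + b *: y) = a^* * hform A z x + b^* * hform A z y.
Proof.
move=> hA; rewrite (hformC _ _ hA) hformDl rmorphD !rmorphM /=.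
by rewrite -!(hformC _ _ hA).
Qed.

Lemma hform_comb A x y a b : A ^t* = A -> hform A x y = 0 ->
  hform A (a *: x + b *: y) (a *: x + b *: y) =
  `|a| ^+ 2 * hform A x x + `|b| ^+ 2 * hform A y y.
Proof.
move=> hA xy0; rewrite hformDl !hformDr // (hformC x y hA) xy0 conjC0.
by rewrite !mulr0 add0r addr0 !mulrA !normCK.
Qed.

Lemma hform_diag (P : 'M[C]_n) (d : 'rV[C]_n) x y :
  hform (P ^t* *m diag_mx d *m P) x y =
  \sum_i d 0 i * (x *m P ^t*) 0 i * ((y *m P ^t*) 0 i)^*.
Proof.
have -> : hform (P ^t* *m diag_mx d *m P) x y =
   hform (diag_mx d) (x *m P ^t*) (y *m P ^t*).
  by rewrite /hform trmx_mul map_mxM trmxCK !mulmxA.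
rewrite hformE; apply: eq_bigr => i _; rewrite (bigD1 i) //= big1 => [|j nji].
  by rewrite addr0 !mxE eqxx mulr1n [_ * d 0 i]mulrC.
by rewrite [diag_mx _ _ _]mxE eq_sym (negPf nji) mulr0n mulr0 mul0r.
Qed.

(** The rows of [P] are orthonormal eigenvectors, so two positive entries of
    [d] give two orthogonal positive vectors.  Conversely, if only [d i0] is
    positive, the form is nonpositive on the hyperplane where the coordinate
    [i0] vanishes, and every plane meets that hyperplane. *)
Lemma no_positive_plane_diag (P : 'M[C]_n) (d : 'rV[C]_n) :
  P \is unitarymx -> (forall i, d 0 i \is Num.real) ->
  no_positive_plane (P ^t* *m diag_mx d *m P) <->
  (forall i j, 0 < d 0 i -> 0 < d 0 j -> i = j).
Proof.
move=> Pu dr; set A := (X in no_positive_plane X).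
have hA : A ^t* = A.
  rewrite /A !trmx_mul !map_mxM trmxCK mulmxA tr_diag_mx map_diag_mx.
  congr (_ *m diag_mx _ *m _); apply/rowP => i; rewrite mxE.
  exact/CrealP/dr.
have rowP i k : (row i P *m P ^t*) 0 k = (i == k)%:R.
  by rewrite -row_mul (unitarymxP Pu) !mxE.
have rowQ i j : hform A (row i P) (row j P) = d 0 i * (i == j)%:R.
  rewrite hform_diag (bigD1 i) //= big1 => [|k nki]; last first.
    by rewrite rowP eq_sym (negPf nki) mulr0 mul0r.
  by rewrite !rowP eqxx mulr1 addr0 conjC_nat eq_sym.
split=> [npp i j di dj | uniq_pos x y xy0 Qx Qy].
  apply/eqP/negPn/negP => nij; apply: (npp (row i P) (row j P)).
  - by rewrite rowQ (negPf nij) mulr0.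
  - by rewrite rowQ eqxx mulr1.
  - by rewrite rowQ eqxx mulr1.
have le0 z : (forall i, 0 < d 0 i -> (z *m P ^t*) 0 i = 0) -> hform A z z <= 0.
  move=> hz; rewrite hform_diag -oppr_ge0 -sumrN; apply: sumr_ge0 => i _.
  have [/hz-> | di] := boolP (0 < d 0 i); first by rewrite mulr0 mul0r oppr0.
  rewrite -mulrA -normCK oppr_ge0 mulr_le0_ge0 ?exprn_ge0 //.
  by rewrite real_leNgt ?real0 ?dr.
have [i0 /= di0 | d0] := pickP (fun i => 0 < d 0 i); last first.
  by case/negP: (negbT (lt_geF Qx)); apply: le0 => i; rewrite d0.
set a := (y *m P ^t*) 0 i0; set b := (x *m P ^t*) 0 i0.
have b0 : b != 0.
  apply/eqP => b0; case/negP: (negbT (lt_geF Qx)); apply: le0 => i di.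
  by rewrite (uniq_pos _ _ di di0) -b0.
(* The combination of [x] and [y] whose coordinate [i0] vanishes. *)
have : hform A (a *: x + - b *: y) (a *: x + - b *: y) <= 0.
  apply: le0 => i di; rewrite (uniq_pos _ _ di di0) mulmxDl -!scalemxAl !mxE.
  by have := subrr (a * b); rewrite [X in _ - X]mulrC mulNr /a /b !mxE.
apply/negP; rewrite -real_ltNge ?real0 //; last first.
  rewrite hform_comb //; apply: ger0_real.
  by apply: addr_ge0; apply: mulr_ge0; rewrite ?exprn_ge0 // ltW.
rewrite hform_comb //; apply: ltr_wpDl.
  by rewrite mulr_ge0 ?exprn_ge0 // ltW.
by rewrite mulr_gt0 // exprn_gt0 // normr_gt0 oppr_eq0.
Qed.

Lemma no_positive_planeZ A c : 0 < c ->
  no_positive_plane A -> no_positive_plane (c *: A).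
Proof.
move=> c0 npp x y; have E u v : hform (c *: A) u v = c * hform A u v.
  by rewrite /hform -scalemxAr -scalemxAl mxE.
rewrite !E !pmulr_rgt0 // => /eqP; rewrite mulf_eq0 gt_eqF //= => /eqP.
exact: npp.
Qed.

Lemma no_positive_plane_conj A B :
  no_positive_plane A -> no_positive_plane (B *m A *m B ^t*).
Proof.
move=> npp x y.
have E u v : hform (B *m A *m B ^t*) u v = hform A (u *m B) (v *m B).
  by rewrite /hform trmx_mul map_mxM !mulmxA.
by rewrite !E; apply: npp.
Qed.

(** A plane positive for [B] is positive for [A]; the basis orthogonal for [B]
    has to be made orthogonal for [A] again. *)
Lemma no_positive_plane_le A B : A ^t* = A -> B ^t* = B ->
  (forall x, hform B x x <= hform A x x) ->
  no_positive_plane A -> no_positive_plane B.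
Proof.
move=> hA hB leBA npp x y xy0 Qx Qy.
have QAx : 0 < hform A x x := lt_le_trans Qx (leBA x).
pose c := - ((hform A x y)^* / hform A x x).
apply: (npp x (c *: x + 1 *: y)) => //.
  rewrite hformDr // conjC1 mul1r /c rmorphN rmorphM /= conjCK fmorphV.
  rewrite /= -(hformC x x hA) mulNr divfK ?addNr //.
  by rewrite gt_eqF.
apply: lt_le_trans (leBA _); rewrite hform_comb // normr1 expr1n mul1r.
by apply: ltr_wpDl; rewrite // mulr_ge0 ?exprn_ge0 // ltW.
Qed.

End HermitianForm.

(** * Real symmetric matrices and their positive eigenvalues *)

Lemma char_poly_conj (R : comNzRingType) n (P Q A : 'M[R]_n) :
  Q *m P = 1%:M -> char_poly (Q *m A *m P) = char_poly A.
Proof.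
move=> QP; have QPx : map_mx polyC Q *m map_mx polyC P = 1%:M.
  by rewrite -map_mxM QP map_mx1.
rewrite /char_poly; have -> : char_poly_mx (Q *m A *m P) =
    map_mx polyC Q *m char_poly_mx A *m map_mx polyC P.
  rewrite /char_poly_mx mulmxBr mulmxBl !map_mxM mul_mx_scalar -scalemxAl.
  by rewrite QPx scalemx1.
by rewrite !det_mulmx mulrC mulrA -det_mulmx (mulmx1C QPx) det1 mul1r.
Qed.

Section RealSymmetric.
Local Open Scope sesquilinear_scope.
Variables (R : rcfType) (n : nat).
Local Notation toC := (real_complex R).

Lemma map_real_hermitian (A : 'M[R]_n) : A^T = A ->
  (map_mx toC A) ^t* = map_mx toC A.
Proof.
move=> sA; rewrite map_trmx sA; apply/matrixP => i j; rewrite !mxE.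
exact: conjc_real.
Qed.

(** The diagonalization is over [R[i]], but the eigenvalues are real, which is
    why the characteristic polynomial splits over [R] itself. *)
Lemma real_symmetric_spectral (A : 'M[R]_n) : A^T = A ->
  exists (P : 'M[R[i]]_n) (d : 'rV[R]_n),
    [/\ P \is unitarymx,
        map_mx toC A = P ^t* *m diag_mx (map_mx toC d) *m P
      & char_poly A = \prod_(i < n) ('X - (d 0 i)%:P)].
Proof.
move=> sA; set B := map_mx toC A.
have hB : B \is hermsymmx.
  by apply/is_hermitianmxP; rewrite expr0 scale1r map_real_hermitian.
have /orthomx_spectralP := hermitian_normalmx hB.
have Pu := spectral_unitarymx B.
have /mxOverP dR := hermitian_spectral_diag_real hB.
move: (spectralmx B) Pu (spectral_diag B) dR => P Pu e eR.
rewrite invmx_unitary // => BE.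
pose d : 'rV[R]_n := \row_i complex.Re (e 0 i).
have eE : e = map_mx toC d.
  apply/rowP => i; rewrite !mxE; have := eR 0 i.
  by move/Creal_ReP; rewrite /toC -complexRe.
exists P, d; split=> //; first by rewrite BE eE.
apply: (map_poly_inj toC).
rewrite map_char_poly rmorph_prod /=.
have -> : char_poly B = char_poly (diag_mx e).
  by rewrite BE char_poly_conj // -invmx_unitary // mulVmx // unitarymx_unit.
rewrite char_poly_trig ?diag_mx_is_trig //; apply: eq_bigr => i _.
by rewrite rmorphB /= map_polyX map_polyC /= eE !mxE eqxx mulr1n.
Qed.

Lemma sum_mup_prod (s : seq R) (d : 'I_n -> R) : uniq s ->
  (\sum_(l <- s) mup l (\prod_(i < n) ('X - (d i)%:P)%R) =
    #|[pred i | d i \in s]|)%N.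
Proof.
move=> us; pose t := [seq d i | i <- enum 'I_n].
have -> : \prod_(i < n) ('X - (d i)%:P) = \prod_(y <- t) ('X - y%:P).
  by rewrite big_map big_enum.
rewrite (eq_bigr (fun l => count_mem l t)) => [|l _]; last exact: mu_prod_XsubC.
have -> : #|[pred i | d i \in s]| = count (mem s) t.
  by rewrite cardE /enum_mem size_filter count_map enumT; apply: eq_count.
elim: t => [|y t IH] /=; first by rewrite big1.
rewrite big_split /= IH -(count_uniq_mem y us); congr addn.
rewrite -sum1_count [RHS]big_mkcond; apply: eq_bigr => l _.
by rewrite /= eq_sym; case: eqP.
Qed.

End RealSymmetric.

Lemma at_most_one_pos_eigenvalueP (R : realType) n (A : 'M[R]_n) : A^T = A ->
  at_most_one_pos_eigenvalue A <->
  no_positive_plane (map_mx (real_complex R) A).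
Proof.
move=> sA; have [P [d [Pu AE chA]]] := real_symmetric_spectral sA.
set dC := map_mx _ d in AE.
have dE i : dC 0 i = real_complex R (d 0 i) by rewrite mxE.
have dr i : dC 0 i \is Num.real by rewrite dE complex_real.
have dpos i : (0 < dC 0 i) = (0 < d 0 i) by rewrite dE ltcR.
rewrite AE (no_positive_plane_diag Pu dr) /at_most_one_pos_eigenvalue chA.
have eig l : eigenvalue A l = (l \in [seq d 0 i | i <- enum 'I_n]).
  rewrite enumT eigenvalue_root_char chA.
  by rewrite -(big_map _ xpredT (fun y => 'X - y%:P)) root_prod_XsubC.
split=> [amo i j | inj s us spos].
  rewrite !dpos => di dj.
  have := amo (undup [seq d 0 i | i <- enum 'I_n & 0 < d 0 i]) (undup_uniq _).
  rewrite sum_mup_prod ?undup_uniq // => /(_ _)/card_le1_eqP; apply.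
  - move=> l; rewrite mem_undup => /mapP[k].
    rewrite mem_filter => /andP[dk _] ->.
    by split=> //; rewrite eig map_f // mem_enum.
  - rewrite inE mem_undup; apply: (map_f (fun i => d 0 i)).
    by rewrite mem_filter /= dj mem_enum.
  - rewrite inE mem_undup; apply: (map_f (fun i => d 0 i)).
    by rewrite mem_filter /= di mem_enum.
rewrite sum_mup_prod //; apply/card_le1_eqP => i j.
by rewrite !inE => /spos[di _] /spos[dj _]; apply: inj; rewrite dpos.
Qed.

(** * Two operations on real quadratic forms *)

Section RealForm.
Variables (R : rcfType) (n : nat).
Local Notation toC := (real_complex R).

Lemma hform_real (A : 'M[R]_n) (x y : 'rV[R]_n) :
  hform (map_mx toC A) (map_mx toC x) (map_mx toC y) =
  toC (\sum_i \sum_j x 0 i * A i j * y 0 j).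
Proof.
rewrite hformE rmorph_sum; apply: eq_bigr => i _.
rewrite rmorph_sum; apply: eq_bigr => j _.
have conjR (c : R) : (toC c)^* = toC c by apply: conjc_real.
by rewrite !mxE !rmorphM /= conjR.
Qed.

Lemma real_form_delta (A : 'M[R]_n) (i j : 'I_n) :
  \sum_k \sum_l (delta_mx 0 i : 'rV[R]_n) 0 k * A k l
    * (delta_mx 0 j : 'rV[R]_n) 0 l = A i j.
Proof.
rewrite (bigD1 i) //= [X in _ + X]big1 ?addr0 => [|k nk].
  rewrite (bigD1 j) //= [X in _ + X]big1 ?addr0 => [|l nl].
    by rewrite !mxE !eqxx mul1r mulr1.
  by rewrite !mxE !eqxx /= (negPf nl) mulr0.
by rewrite big1 // => l _; rewrite !mxE eqxx /= (negPf nk) !mul0r.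
Qed.

(** Let [A] vanish on the span of [e_i, e_j].  If the minor [D] is nonzero,
    this span is dual to that of [e_k, e_l], so correcting [e_k] and [e_l] by
    suitable elements of the isotropic plane makes them orthogonal and raises
    both values of the form by 2. *)
Lemma no_positive_plane_isotropic (A : 'M[R]_n) (i j k l : 'I_n) : A^T = A ->
  no_positive_plane (map_mx toC A) ->
  A i i = 0 -> A i j = 0 -> A j j = 0 -> 0 <= A k k -> 0 <= A l l ->
  A i k * A j l = A i l * A j k.
Proof.
move=> sA npp ii ij jj kk ll.
apply/eqP; rewrite -subr_eq0; apply/negPn/negP => D0.
set D := _ - _ in D0.
have sym a b : A a b = A b a by rewrite -{1}sA mxE.
pose e a : 'rV[R]_n := delta_mx 0 a.
pose B (x y : 'rV[R]_n) := \sum_i \sum_j x 0 i * A i j * y 0 j.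
have BDl a b x y z : B (a *: x + b *: y) z = a * B x z + b * B y z.
  rewrite /B !mulr_sumr -big_split; apply: eq_bigr => p _.
  rewrite !mulr_sumr -big_split; apply: eq_bigr => q _.
  by rewrite !mxE /=; ring.
have BDr a b x y z : B z (a *: x + b *: y) = a * B z x + b * B z y.
  rewrite /B !mulr_sumr -big_split; apply: eq_bigr => p _.
  rewrite !mulr_sumr -big_split; apply: eq_bigr => q _.
  by rewrite !mxE /=; ring.
have Be a b : B (e a) (e b) = A a b by apply: real_form_delta.
pose comb p q m : 'rV[R]_n := 1 *: (p *: e i + q *: e j) + 1 *: e m.
have Bcomb p q m p' q' m' : B (comb p q m) (comb p' q' m') =
   A m m' + (p * A i m' + q * A j m') + (p' * A i m + q' * A j m).
  rewrite /comb !(BDl, BDr) !Be !(sym j i) !(sym m) ii ij jj.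
  by ring.
(* In the pairing with [(e_k, e_l)], the correction of [e_k] has values
   [(1, - z)] and that of [e_l] has values [(0, 1)]: Cramer's rule. *)
pose z := A k l.
pose x := comb ((A j l + z * A j k) / D) (- (A i l + z * A i k) / D) k.
pose y := comb (- A j k / D) (A i k / D) l.
have Bxx : B x x = A k k + 2.
  by rewrite /x Bcomb /D; field.
have Byy : B y y = A l l + 2.
  by rewrite /y Bcomb /D; field.
have Bxy : B x y = 0.
  by rewrite /x /y Bcomb /z /D; field.
apply: (npp (map_mx toC x) (map_mx toC y)).
- by rewrite hform_real -/(B _ _) Bxy.
- by rewrite hform_real -/(B _ _) ltcR Bxx ltr_wpDl.
by rewrite hform_real -/(B _ _) ltcR Byy ltr_wpDl.
Qed.

(** Rows and columns outside [s] are deleted, which restricts the form; on the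
    rest, a nonnegative diagonal form is subtracted. *)
Lemma no_positive_plane_truncate (A : 'M[R]_n) (s t : pred 'I_n) : A^T = A ->
  (forall i, 0 <= A i i) -> no_positive_plane (map_mx toC A) ->
  no_positive_plane (map_mx toC
    (\matrix_(i, j) if [&& s i, s j & (i == j) ==> t i] then A i j else 0)).
Proof.
move=> sA A0 npp.
pose S : 'rV[R]_n := \row_i (s i)%:R; pose B := diag_mx S *m A *m diag_mx S.
have BE i j : B i j = (s i)%:R * A i j * (s j)%:R.
  by rewrite /B mul_mx_diag mxE mul_diag_mx !mxE.
have sS : (diag_mx S)^T = diag_mx S by rewrite tr_diag_mx.
have sB : B^T = B by rewrite /B !trmx_mul sA sS mulmxA.
have nppB : no_positive_plane (map_mx toC B).
  have := @no_positive_plane_conj _ _ _ (map_mx toC (diag_mx S)) npp.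
  by rewrite (map_real_hermitian sS) -!map_mxM.
apply: no_positive_plane_le nppB; try exact: map_real_hermitian.
  apply: map_real_hermitian; apply/matrixP => i j; rewrite !mxE.
  rewrite -{1}sA mxE [j == i]eq_sym andbCA.
  by case: eqP => [->|].
move=> x; rewrite !hformE -subr_ge0 -sumrB; apply: sumr_ge0 => i _.
rewrite -sumrB; apply: sumr_ge0 => j _; rewrite -mulrBl -mulrBr.
have -> : map_mx toC B i j = toC ((s i)%:R * A i j * (s j)%:R).
  by rewrite mxE BE.
rewrite 2!mxE -rmorphB.
have [<-|nij] := eqVneq i j.
  rewrite mulrAC -normCK mulr_ge0 ?exprn_ge0 // lecR subr_ge0.
  by case: (s i); case: (t i); rewrite /= ?mul1r ?mulr1 ?mul0r.
rewrite implyFb andbT.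
case: (s i); case: (s j); rewrite /= ?mul1r ?mulr1 ?mulr0 ?mul0r;
  by rewrite subrr mulr0 mul0r.
Qed.

End RealForm.

(** * Exponent vectors and exchange *)

(** Adding and subtracting unit vectors at [i] and [j] only matters at a
    coordinate [l] equal to one of them. *)
Tactic Notation "unit_lia" hyp(i) hyp(j) hyp(l) :=
  case: (eqVneq i l) => [<-|_]; case: (eqVneq j _) => [?|_]; try subst j; lia.

Section Multinomials.
Variable n : nat.
Implicit Types (a b x y : 'X_{1..n}) (i j l : 'I_n).

Lemma ltn_mdeg a b i : (a <= b)%MM -> (a i < b i)%N -> (mdeg a < mdeg b)%N.
Proof.
move=> /mnm_lepP ab abi; rewrite !mdegE.
rewrite (bigD1 i) //= [X in (_ < X)%N](bigD1 i) //=.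
by rewrite -addSn leq_add // leq_sum.
Qed.

Lemma leq_mdeg a b : (a <= b)%MM -> (mdeg a <= mdeg b)%N.
Proof. by move=> /mnm_lepP ab; rewrite !mdegE leq_sum. Qed.

Lemma lepm_mdeg_eq a b : (a <= b)%MM -> (mdeg b <= mdeg a)%N -> a = b.
Proof.
move=> ab ba; apply/mnmP => i; have := mnm_lepP ab i.
rewrite leq_eqVlt => /orP[/eqP //|/(ltn_mdeg ab)].
by rewrite ltnNge ba.
Qed.

Lemma exists_ltn_mdeg a b : (mdeg a < mdeg b)%N -> exists i, (a i < b i)%N.
Proof.
move=> ab; apply/existsP; apply: contraLR ab => /existsPn ba.
by rewrite -leqNgt leq_mdeg //; apply/mnm_lepP => i; rewrite leqNgt.
Qed.

Lemma exists_ltn_neq a b : mdeg a = mdeg b -> a != b -> exists i, (a i < b i)%N.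
Proof.
move=> ab nab; apply/existsP; apply: contraNT nab => /existsPn ba.
apply/eqP/esym/lepm_mdeg_eq; last by rewrite ab.
by apply/mnm_lepP => i; rewrite leqNgt.
Qed.

Lemma mdeg_move a i j : (0 < a j)%N -> mdeg (a + U_(i) - U_(j))%MM = mdeg a.
Proof.
move=> aj; have : (a + U_(i) - U_(j) + U_(j) = a + U_(i))%MM.
  apply/mnmP => l; rewrite !mnmE; case: (eqVneq j l) => [<-|_]; lia.
by move/(congr1 (@mdeg n)); rewrite !mdegD !mdeg1; lia.
Qed.

(** The truncated difference [b - a] measures how far [a] is from [b]; an
    exchange decreases it. *)
Lemma ltn_dist_step a b i j : (a i < b i)%N -> (b j < a j)%N ->
  (mdeg (b - (a + U_(i) - U_(j)))%MM < mdeg (b - a)%MM)%N.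
Proof.
move=> abi baj; apply: (@ltn_mdeg _ _ i); last first.
  rewrite !mnmE eqxx.
  by case: (eqVneq j i) => [E|_]; [move: abi baj; rewrite E|]; lia.
by apply/mnm_lepP => l; rewrite !mnmE; unit_lia i j l.
Qed.

End Multinomials.

Section Exchange.
Variable n : nat.
Implicit Types (a b : 'X_{1..n}) (P : {fset 'X_{1..n}}).

(** The half of the M-convex exchange that moves [a] towards [b], which is
    enough to walk inside [P] from [a] to [b]. *)
Definition exchange P : Prop := forall a b i,
  a \in P -> b \in P -> (a i < b i)%N ->
  exists2 j, (b j < a j)%N & (a + U_(i) - U_(j))%MM \in P.

Lemma exchange_connected (T : Type) (F : 'X_{1..n} -> T) P r : exchange P ->
  (forall a, a \in P -> mdeg a = r) ->
  (forall a i j, a \in P -> i != j -> (0 < a j)%N ->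
    (a + U_(i) - U_(j))%MM \in P -> F a = F (a + U_(i) - U_(j))%MM) ->
  forall a b, a \in P -> b \in P -> F a = F b.
Proof.
move=> exP degP stepF a b aP bP.
have [d] := ubnP (mdeg (b - a)%MM); elim: d a aP => // d IH a aP ltd.
have [-> //|nab] := eqVneq a b.
have [i abi] : exists i, (a i < b i)%N.
  by apply: exists_ltn_neq => //; rewrite !degP.
have [j baj a'P] := exP _ _ _ aP bP abi.
rewrite (stepF a i j) //; last 2 first.
- by apply/eqP => E; move: abi baj; rewrite E; lia.
- lia.
by apply: IH => //; apply: leq_trans (ltn_dist_step abi baj) _.
Qed.

End Exchange.

(** * The retraction of an M-convex set *)

Section Retraction.
Variables (n r : nat) (k : 'X_{1..n}) (J : {fset 'X_{1..n}}).
Hypothesis MJ : M_convex r J.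
Implicit Types (a b x t : 'X_{1..n}) (i j l : 'I_n).

Let p := proj k.

Lemma projE a i : proj k a i = minn (a i) (k i).
Proof. by rewrite mnmE. Qed.

Lemma max_partP a : reflect
  (a \in J /\ forall b, b \in J -> (p a <= p b)%MM -> p b = p a)
  (a \in max_part k J).
Proof.
rewrite /max_part !inE /=; apply: (iffP andP) => -[aJ].
  move=> /andP[_ /forallP mx]; split=> // b bJ le.
  by apply/eqP; have := mx [` in_imfset _ (proj k) bJ]; rewrite /= le.
move=> mx; split=> //; rewrite in_imfset //=.
apply/forallP => -[y yP] /=; apply/implyP => le.
by case/imfsetP: yP le => /= b bJ -> le; apply/eqP/mx.
Qed.

(** Otherwise the projection would grow at [i] and lose nothing at [j]. *)
Lemma max_part_not_truncated a i j :
  a \in max_part k J -> (a i < k i)%N -> i != j ->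
  (a + U_(i) - U_(j))%MM \in J -> (a j <= k j)%N.
Proof.
move=> /max_partP[aJ mx] aik nij a'J; rewrite leqNgt; apply/negP => kaj.
have /(mx _ a'J)/mnmP/(_ i) : (p a <= p (a + U_(i) - U_(j)))%MM.
  apply/mnm_lepP => l; rewrite !projE !mnmE.
  by case: (eqVneq j l) => [<-|_]; lia.
by rewrite !projE !mnmE eqxx eq_sym (negPf nij); lia.
Qed.

(** A counterexample [b] closest to [a] would exchange with [a] into a closer
    one: as [j] is not truncated in [a], the step towards [a] gains at [j] at
    least what it loses at [i]. *)
Lemma max_part_mdeg_max a b : a \in max_part k J -> b \in J ->
  (mdeg (p b) <= mdeg (p a))%N.
Proof.
move=> aM; have [aJ _] := max_partP _ aM.
have [d] := ubnP (mdeg (b - a)%MM); elim: d b => // d IH b ltd bJ.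
rewrite leqNgt; apply/negP => ltab.
have [i pabi] := exists_ltn_mdeg ltab; rewrite !projE in pabi.
have [abi aki] : (a i < b i)%N /\ (a i < k i)%N by lia.
have [_ _ /(_ _ _ _ aJ bJ abi)[j [baj a'J b'J]]] := MJ.
have nij : i != j by apply/eqP => E; move: abi baj; rewrite E; lia.
have ajk := max_part_not_truncated aM aki nij a'J.
have := IH _ _ b'J; have -> : (mdeg ((b - U_(i) + U_(j)) - a)%MM < d)%N.
  rewrite -ltnS; apply: leq_trans ltd; rewrite ltnS; apply: (@ltn_mdeg _ _ _ i).
    by apply/mnm_lepP => l; rewrite !mnmE; unit_lia i j l.
  by rewrite !mnmE eqxx eq_sym (negPf nij); lia.
move=> /(_ isT); apply/negP; rewrite -ltnNge; apply: leq_trans ltab _.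
have : (p b + U_(j) <= p (b - U_(i) + U_(j)) + U_(i))%MM.
  by apply/mnm_lepP => l; rewrite !mnmE; unit_lia i j l.
by move/leq_mdeg; rewrite !mdegD !mdeg1; lia.
Qed.

Lemma max_part_mdeg a b : a \in max_part k J -> b \in J ->
  (mdeg (p a) <= mdeg (p b))%N -> b \in max_part k J.
Proof.
move=> aM bJ ab; apply/max_partP; split=> // c cJ le.
apply/esym/lepm_mdeg_eq => //.
exact: leq_trans (max_part_mdeg_max aM cJ) ab.
Qed.

Lemma max_part_sub a : a \in max_part k J -> a \in J.
Proof. by case/max_partP. Qed.

(** By maximality of [a] and of [b], neither [j] in [a] nor [i] in [b] is
    truncated, so the exchange takes place entirely inside the projections. *)
Lemma max_part_exchange a b i : a \in max_part k J -> b \in max_part k J ->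
  (p a i < p b i)%N ->
  exists j, [/\ (p b j < p a j)%N,
    (a + U_(i) - U_(j))%MM \in max_part k J,
    (b - U_(i) + U_(j))%MM \in max_part k J,
    p (a + U_(i) - U_(j))%MM = (p a + U_(i) - U_(j))%MM &
    p (b - U_(i) + U_(j))%MM = (p b - U_(i) + U_(j))%MM
      /\ (b - U_(i) + U_(j) - p (b - U_(i) + U_(j)) = b - p b)%MM].
Proof.
move=> aM bM; rewrite !projE => H.
have [abi aki] : (a i < b i)%N /\ (a i < k i)%N by lia.
have [aJ bJ] := (max_part_sub aM, max_part_sub bM).
have [_ _ /(_ _ _ _ aJ bJ abi)[j [baj a'J b'J]]] := MJ.
have nij : i != j by apply/eqP => E; move: abi baj; rewrite E; lia.
have ajk := max_part_not_truncated aM aki nij a'J.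
have bik : (b i <= k i)%N.
  apply: (@max_part_not_truncated b j i) => //; rewrite 1?eq_sym //; first lia.
  have <- // : (b - U_(i) + U_(j) = b + U_(j) - U_(i))%MM.
  by apply/mnmP => l; rewrite !mnmE; unit_lia i j l.
have pa' : p (a + U_(i) - U_(j))%MM = (p a + U_(i) - U_(j))%MM.
  by apply/mnmP => l; rewrite !mnmE; unit_lia i j l.
have pb' : p (b - U_(i) + U_(j))%MM = (p b - U_(i) + U_(j))%MM.
  by apply/mnmP => l; rewrite !mnmE; unit_lia i j l.
exists j; split=> //.
- by rewrite !projE; lia.
- by apply: max_part_mdeg aM a'J _; rewrite pa' mdeg_move // projE; lia.
- apply: max_part_mdeg bM b'J _; rewrite pb'.
  have : (p b + U_(j) <= p b - U_(i) + U_(j) + U_(i))%MM.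
    by apply/mnm_lepP => l; rewrite !mnmE; lia.
  by move/leq_mdeg; rewrite !mdegD !mdeg1; lia.
split=> //; rewrite pb'; apply/mnmP => l; rewrite !mnmE.
by unit_lia i j l.
Qed.

(** Exchanges move [p b] to [p a] while the section vector of [b] stays put. *)
Lemma max_part_product a b : a \in max_part k J -> b \in max_part k J ->
  (p a + (b - p b))%MM \in max_part k J /\ p (p a + (b - p b))%MM = p a.
Proof.
move=> aM; have [d] := ubnP (mdeg (p b - p a)%MM).
elim: d b => // d IH b ltd bM.
have pab : mdeg (p a) = mdeg (p b).
  by apply/eqP; rewrite eqn_leq !max_part_mdeg_max ?max_part_sub.
have [E|nab] := eqVneq (p a) (p b).
  rewrite E; have -> // : (p b + (b - p b) = b)%MM.
  by apply/mnmP => l; rewrite !mnmE; lia.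
have [i abi] := exists_ltn_neq pab nab.
have [j [baj _ b'M _ [pb' <-]]] := max_part_exchange aM bM abi.
apply: IH => //; rewrite -ltnS; apply: leq_trans ltd; rewrite ltnS.
have nij : i != j by apply/eqP => E; move: abi baj; rewrite E; lia.
rewrite pb'; apply: (@ltn_mdeg _ _ _ i).
  apply/mnm_lepP => l; move: abi baj; rewrite !mnmE.
  by unit_lia i j l.
by move: abi; rewrite !mnmE eqxx eq_sym (negPf nij); lia.
Qed.

Lemma ret_setP x :
  reflect (exists2 a, a \in max_part k J & x = p a) (x \in ret_set k J).
Proof. exact: (iffP (imfsetP _ _ _ _)). Qed.

Lemma section_vectorsP t :
  reflect (exists2 a, a \in max_part k J & t = (a - p a)%MM)
          (t \in section_vectors k J).
Proof. exact: (iffP (imfsetP _ _ _ _)). Qed.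

Lemma ret_section_max x t : x \in ret_set k J -> t \in section_vectors k J ->
  (x + t)%MM \in max_part k J /\ p (x + t)%MM = x.
Proof.
move=> /ret_setP[a aM ->] /section_vectorsP[b bM ->].
exact: max_part_product.
Qed.

(** [x + t] projects back to [x], so [t] lives on coordinates where [x] has
    reached the bound [k]. *)
Lemma section_saturated x t i :
  x \in ret_set k J -> t \in section_vectors k J -> (0 < t i)%N -> x i = k i.
Proof.
move=> xR tT ti; have [_ /mnmP/(_ i)] := ret_section_max xR tT.
by rewrite !mnmE; lia.
Qed.

Lemma ret_set_le x i : x \in ret_set k J -> (x i <= k i)%N.
Proof. by case/ret_setP => a _ ->; rewrite projE; lia. Qed.

Lemma ret_set_mdeg x y :
  x \in ret_set k J -> y \in ret_set k J -> mdeg x = mdeg y.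
Proof.
move=> /ret_setP[a aM ->] /ret_setP[b bM ->].
by apply/eqP; rewrite eqn_leq !max_part_mdeg_max ?max_part_sub.
Qed.

(** Together with [ret_set_le], this says that the [ret_section] at [t] is the
    part below [k] of a derivative: one fixed [t] detects [ret_set]. *)
Lemma ret_set_charac x0 x t :
  x0 \in ret_set k J -> t \in section_vectors k J ->
  mdeg x = mdeg x0 -> (forall i, x i <= k i)%N -> (x + t)%MM \in J ->
  x \in ret_set k J.
Proof.
move=> /ret_setP[a aM ->] tT dx xk xtJ.
have E : x = p (x + t)%MM.
  apply: lepm_mdeg_eq; last by rewrite dx max_part_mdeg_max.
  by apply/mnm_lepP => i; have := xk i; rewrite !mnmE; lia.
apply/ret_setP; exists (x + t)%MM => //.
by apply: (max_part_mdeg aM) => //; rewrite -E dx.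
Qed.

Lemma max_part_neq0 : exists a, a \in max_part k J.
Proof.
have [/fset0Pn[a0 a0J] _ _] := MJ.
pose deg (c : J) := mdeg (p (val c)).
have [/= c _ mx] := @arg_maxnP J [` a0J] xpredT deg isT.
exists (val c); apply/max_partP; split=> [|b bJ le]; first exact: valP.
by apply/esym/lepm_mdeg_eq => //; exact: (mx [` bJ] isT).
Qed.

Lemma ret_set_exchange x y i :
  x \in ret_set k J -> y \in ret_set k J -> (x i < y i)%N ->
  exists j, [/\ (y j < x j)%N, (x + U_(i) - U_(j))%MM \in ret_set k J
                 & (y - U_(i) + U_(j))%MM \in ret_set k J].
Proof.
move=> /ret_setP[a aM ->] /ret_setP[b bM ->] /(max_part_exchange aM bM).
move=> [j [baj a'M b'M pa' [pb' _]]]; exists j; split=> //.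
  by rewrite -pa'; apply/ret_setP; eexists; first exact: a'M.
by rewrite -pb'; apply/ret_setP; eexists; first exact: b'M.
Qed.

Lemma M_convex_ret_set x0 :
  x0 \in ret_set k J -> M_convex (mdeg x0) (ret_set k J).
Proof.
move=> x0R; split; first by apply/fset0Pn; exists x0.
  by move=> x xR; apply: ret_set_mdeg.
exact: ret_set_exchange.
Qed.

Lemma exchange_ret_set : exchange (ret_set k J).
Proof.
by move=> x y i xR yR /(ret_set_exchange xR yR)[j [yxj x'R _]]; exists j.
Qed.

Lemma mdeg_section_vectors x t :
  x \in ret_set k J -> t \in section_vectors k J ->
  mdeg t = (r - mdeg x)%N.
Proof.
move=> xR tT; have [/max_part_sub xtJ _] := ret_section_max xR tT.
by have [_ /(_ _ xtJ) <- _] := MJ; rewrite mdegD addKn.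
Qed.

(** Exchange [x + t] with [x + t'] for one common [x]: both coordinates
    involved are saturated in [x], so the projection does not move. *)
Lemma exchange_section_vectors : exchange (section_vectors k J).
Proof.
move=> t t' i tT t'T tt'i; have [a0 a0M] := max_part_neq0.
have xR : p a0 \in ret_set k J by apply/ret_setP; exists a0.
move: (p a0) xR => x xR.
have [aM pa] := ret_section_max xR tT; have [bM pb] := ret_section_max xR t'T.
have ltab : ((x + t)%MM i < (x + t')%MM i)%N by rewrite !mnmE; lia.
have [_ _ /(_ _ _ _ (max_part_sub aM) (max_part_sub bM) ltab)] := MJ.
move=> [j [baj a'J _]]; exists j; first by move: baj; rewrite !mnmE; lia.
have xi := section_saturated xR t'T (leq_ltn_trans (leq0n _) tt'i).
have tj : (0 < t j)%N by move: baj; rewrite !mnmE; lia.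
have xj := section_saturated xR tT tj.
have E : (x + t + U_(i) - U_(j) = x + (t + U_(i) - U_(j)))%MM.
  apply/mnmP => l; rewrite !mnmE.
  by case: (eqVneq j l) => [<-|_]; lia.
have pa' : p (x + t + U_(i) - U_(j))%MM = x.
  apply/mnmP => l; rewrite !mnmE; have := ret_set_le l xR.
  move/mnmP/(_ l): pa; rewrite !mnmE.
  by unit_lia i j l.
apply/section_vectorsP; exists (x + t + U_(i) - U_(j))%MM.
  by apply: (max_part_mdeg aM) => //; rewrite pa pa'.
by rewrite pa' E [(x + _)%MM]addmC addmK.
Qed.

(** If [y] were in [J], it would project to [w], so it would exceed the bound
    at [v] and make [v] saturated in all of [ret_set], [x] included. *)
Lemma ret_set_raise w x y v : w \in ret_set k J -> x \in ret_set k J ->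
  (x v < k v)%N -> (w + U_(v) <= y)%MM -> y \notin J.
Proof.
move=> wR xR xv /mnm_lepP wy; apply/negP => yJ.
have /ret_setP[a aM wE] := wR.
have le : (w <= proj k y)%MM.
  apply/mnm_lepP => i; have := wy i; have := ret_set_le i wR.
  by rewrite !mnmE; lia.
have yM : y \in max_part k J.
  by apply: (max_part_mdeg aM) => //; rewrite -wE leq_mdeg.
have E : w = proj k y.
  by apply: lepm_mdeg_eq => //; rewrite wE; apply: max_part_mdeg_max.
have tT : (y - proj k y)%MM \in section_vectors k J.
  by apply/section_vectorsP; exists y.
have := section_saturated xR tT (i := v); have := wy v.
by rewrite {1}E !mnmE eqxx; lia.
Qed.

End Retraction.

(** * Functions of rank one on a product of connected sets *)

Section RankOne.
Variables (n : nat) (F : fieldType) (c : 'X_{1..n} -> 'X_{1..n} -> F).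
Variables P Q : {fset 'X_{1..n}}.
Hypotheses (exP : exchange P) (exQ : exchange Q).
Hypothesis degP : {in P &, forall x y, mdeg x = mdeg y}.
Hypothesis degQ : {in Q &, forall x y, mdeg x = mdeg y}.
Hypothesis c_neq0 : forall x t, x \in P -> t \in Q -> c x t != 0.
Hypothesis minor0 : forall x t i j p q,
  x \in P -> i != j -> (0 < x j)%N -> (x + U_(i) - U_(j))%MM \in P ->
  t \in Q -> p != q -> (0 < t q)%N -> (t + U_(p) - U_(q))%MM \in Q ->
  c x t * c (x + U_(i) - U_(j))%MM (t + U_(p) - U_(q))%MM =
  c x (t + U_(p) - U_(q))%MM * c (x + U_(i) - U_(j))%MM t.

(** Connectedness is used in each factor in turn: the minors make
    [c y t / c y' t] constant in [t] for neighbours [y, y'], hence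
    [c y t / c y t'] constant in [y]. *)
Lemma rank_one_ratio x x' t t' : x \in P -> x' \in P -> t \in Q -> t' \in Q ->
  c x t / c x t' = c x' t / c x' t'.
Proof.
move=> xP x'P tQ t'Q.
pose F1 y := c y t / c y t'; rewrite -/(F1 x) -/(F1 x').
apply: (exchange_connected (r := mdeg x) exP) => // [y yP|y i j yP nij yj].
  exact: degP.
rewrite /F1; move E : (y + U_(i) - U_(j))%MM => y' y'P.
pose F2 s := c y s / c y' s.
have : F2 t = F2 t'.
  apply: (exchange_connected (r := mdeg t) exQ) => //.
    by move=> s sQ; apply: degQ.
  move=> s p q sQ npq sq s'Q.
  apply/eqP; rewrite /F2 eqr_div ?c_neq0 //.
  by apply/eqP; rewrite -E minor0 // E.
move/eqP; rewrite /F2 eqr_div ?c_neq0 // => /eqP E2.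
by apply/eqP; rewrite eqr_div ?c_neq0 // E2 mulrC.
Qed.

End RankOne.

(** * Normalized coefficients of derivatives and retractions *)

Section Coefficients.
Variables (R : realType) (n : nat).
Implicit Types (f q : {mpoly R[n]}) (k t a b : 'X_{1..n}).

Lemma mfact_neq0 a : (mfact a)%:R != 0 :> R.
Proof.
by rewrite pnatr_eq0 -lt0n /mfact prodn_gt0 // => i; rewrite fact_gt0.
Qed.

(** The normalization by factorials turns derivation into a shift. *)
Lemma ncoeff_deriv q b a : ncoeff q^`M[b] a = ncoeff q (b + a)%MM.
Proof.
rewrite /ncoeff mcoeff_mderivm mulrnAr -mulrnAl -mulrnA; congr (_%:R * _).
rewrite /mfact -big_split; apply: eq_bigr => i _ /=.
rewrite mnmDE mulnC.
rewrite -[in RHS](@ffact_fact (b i + a i) (b i)) ?leq_addr //.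
by rewrite addKn.
Qed.

Lemma hessian_ncoeff q b :
  hessian q^`M[b] = \matrix_(i, j) ncoeff q (b + U_(i) + U_(j))%MM.
Proof.
apply/matrixP => i j; rewrite !mxE -!mderivmU1m.
have E0 (p : {mpoly R[n]}) : p@_0%MM = ncoeff p 0%MM.
  by rewrite /ncoeff /mfact big1 ?mul1r // => l _; rewrite mnmE.
by rewrite E0 !ncoeff_deriv addm0 -!addmA [(U_(j) + _)%MM]addmC.
Qed.

Lemma hessian_sym q : (hessian q)^T = hessian q.
Proof.
by apply/matrixP => i j; rewrite !mxE -!mderivmU1m -!mderivmDm addmC.
Qed.

Lemma mcoeff_ret k f x :
  (ret k f)@_x = if x \in ret_set k (supp f) then
    (\sum_(t <- section_vectors k (supp f)) ncoeff f (x + t)%MM) / (mfact x)%:R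
  else 0.
Proof.
rewrite /ret raddf_sum /=.
have E t : (ret_section k t f)@_x = if x \in ret_set k (supp f) then
    ncoeff f (x + t)%MM / (mfact x)%:R else 0.
  rewrite /ret_section raddf_sum /=.
  case: ifPn => xR.
    rewrite (big_fsetD1 x) //= mcoeffZ mcoeffX eqxx mulr1.
    rewrite big_seq big1 ?addr0 // => y; rewrite !inE => /andP[/negPf nxy _].
    by rewrite mcoeffZ mcoeffX nxy mulr0.
  rewrite big_seq big1 // => y yR; rewrite mcoeffZ mcoeffX.
  by case: eqVneq xR yR => [->|]; rewrite ?mulr0 // => /negPf->.
rewrite (eq_bigr _ (fun t _ => E t)).
by case: ifP => _; rewrite ?big1_eq // -mulr_suml.
Qed.

Lemma ncoeff_ret k f x :
  ncoeff (ret k f) x = if x \in ret_set k (supp f) then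
    \sum_(t <- section_vectors k (supp f)) ncoeff f (x + t)%MM else 0.
Proof.
rewrite /ncoeff mcoeff_ret; case: ifP => _; last by rewrite mulr0.
by rewrite mulrC divfK // mfact_neq0.
Qed.

Lemma in_supp f a : (a \in supp f) = (f@_a != 0).
Proof. by rewrite !inE mcoeff_msupp. Qed.

Lemma ncoeff_ge0 f a : (forall b, 0 <= f@_b) -> 0 <= ncoeff f a.
Proof. by move=> f0; rewrite mulr_ge0 ?ler0n. Qed.

Lemma ncoeff_gt0 f a :
  (forall b, 0 <= f@_b) -> (0 < ncoeff f a) = (a \in supp f).
Proof.
move=> f0; rewrite in_supp lt_neqAle ncoeff_ge0 // andbT eq_sym.
by rewrite /ncoeff mulf_eq0 negb_or mfact_neq0.
Qed.

Lemma ncoeff_eq0 f a : a \notin supp f -> ncoeff f a = 0.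
Proof. by rewrite in_supp negbK /ncoeff => /eqP->; rewrite mulr0. Qed.

End Coefficients.

(** * Lorentzian polynomials *)

Section Lorentzian.
Variables (R : realType) (n r : nat) (k : 'X_{1..n}) (f : {mpoly R[n]}).
Hypothesis Lf : lorentzian_deg r f.
Local Notation J := (supp f).
Local Notation c := (ncoeff f).

Lemma supp_neq0 (g : {mpoly R[n]}) : g != 0 -> supp g != fset0.
Proof.
move=> g0; apply/fset0Pn.
by exists (mlead g); rewrite in_supp -mcoeff_msupp mlead_supp.
Qed.

(** In degree 0 and 1, where M-convexity is not part of the definition, the
    exponents are 0 or unit vectors and the exchange swaps them. *)
Lemma lorentzian_M_convex : M_convex r J.
Proof.
case: Lf => hom _ f0 f2.
have [r2|/f2[] //] := ltnP r 2.
have dJ a : a \in J -> mdeg a = r.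
  by rewrite in_supp -mcoeff_msupp => am; move/dhomogP: hom => /(_ _ am).
split=> [||a b i aJ bJ abi] //; first exact/supp_neq0/f0.
have dab : mdeg a = mdeg b by rewrite !dJ.
have nab : b != a by apply/eqP => E; rewrite E ltnn in abi.
have [j baj] := exists_ltn_neq (esym dab) nab.
have unit_of (e : 'X_{1..n}) (l : 'I_n) :
    e \in J -> (0 < e l)%N -> e = U_(l)%MM.
  move=> eJ el; apply/esym/lepm_mdeg_eq; last by rewrite mdeg1 dJ.
  by apply/mnm_lepP => q; rewrite mnmE; case: (eqVneq l q) => [<-|].
have aE := unit_of a j aJ (leq_ltn_trans (leq0n _) baj).
have bE := unit_of b i bJ (leq_ltn_trans (leq0n _) abi).
exists j; split=> //.
  by rewrite {1}aE addmC addmK -bE.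
by rewrite {1}bE -{1}[U_(i)%MM]add0m addmK add0m -aE.
Qed.

Lemma lorentzian_hessian b : (mdeg b + 2)%N = r ->
  no_positive_plane (map_mx (real_complex R) (hessian f^`M[b])).
Proof.
case: Lf => _ _ _ f2 db; have /f2[_ /(_ b)] : (2 <= r)%N by lia.
move=> H; apply/(at_most_one_pos_eigenvalueP (hessian_sym _)); apply: H; lia.
Qed.

Let MJ := lorentzian_M_convex.
Let f_ge0 a : 0 <= f@_a. Proof. by case: Lf. Qed.

Lemma ncoeff_gt0_product x t :
  x \in ret_set k J -> t \in section_vectors k J -> 0 < c (x + t)%MM.
Proof.
move=> xR tT; rewrite ncoeff_gt0 //.
by have [/max_part_sub] := ret_section_max MJ xR tT.
Qed.

(** Lowering [x] at [j] and [t] at [q] gives an exponent [b] for which the four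
    coefficients are entries of the Hessian of [f^`M[b]]; the entries indexed
    by [i] and [j] alone belong to exponents that [ret_set_raise] excludes from
    the support. *)
Lemma adjacent_minor x t i j p q :
  x \in ret_set k J -> i != j -> (0 < x j)%N ->
  (x + U_(i) - U_(j))%MM \in ret_set k J ->
  t \in section_vectors k J -> (0 < t q)%N ->
  c (x + t)%MM * c (x + U_(i) - U_(j) + (t + U_(p) - U_(q)))%MM =
  c (x + (t + U_(p) - U_(q)))%MM * c (x + U_(i) - U_(j) + t)%MM.
Proof.
move=> xR nij xj x'R tT tq.
set x' := (x + U_(i) - U_(j))%MM in x'R *.
pose b := (x - U_(j) + (t - U_(q)))%MM.
pose A := hessian f^`M[b].
have AE u v : A u v = c (b + U_(u) + U_(v))%MM by rewrite /A hessian_ncoeff mxE.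
have bE (u v : 'I_n) :
    (b + U_(u) + U_(v) = x + U_(u) - U_(j) + (t + U_(v) - U_(q)))%MM.
  by apply/mnmP => l; rewrite !mnmE; unit_lia j q l.
have cancel (a : 'X_{1..n}) (u : 'I_n) : (a + U_(u) - U_(u) = a)%MM.
  by rewrite addmK.
have x'i : (x i < k i)%N.
  by have := ret_set_le i x'R; rewrite /x' !mnmE eqxx eq_sym (negPf nij); lia.
have x'j : (x' j < k j)%N.
  by have := ret_set_le j xR; rewrite /x' !mnmE eqxx (negPf nij); lia.
have db : (mdeg b + 2)%N = r.
  have [_ dJ _] := MJ; rewrite -(dJ (x + t)%MM); last first.
    by rewrite -ncoeff_gt0 //; apply: ncoeff_gt0_product.
  have <- : (b + U_(j) + U_(q) = x + t)%MM by rewrite bE !cancel.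
  by rewrite !mdegD !mdeg1; lia.
have A0 w x0 u v v' :
    w \in ret_set k J -> x0 \in ret_set k J -> (x0 v' < k v')%N ->
    (w + U_(v') <= b + U_(u) + U_(v))%MM -> A u v = 0.
  move=> wR x0R xv le; rewrite AE; apply: ncoeff_eq0.
  exact: (ret_set_raise MJ wR x0R xv).
have Aij : A i j = 0.
  apply: (A0 x x i j i) => //; apply/mnm_lepP => l; rewrite !mnmE.
  by case: (eqVneq j l) => [<-|_]; lia.
have Aii : A i i = 0.
  apply: (A0 x' x i i i) => //; apply/mnm_lepP => l; rewrite !mnmE.
  by case: (eqVneq j l) => [<-|_]; lia.
have Ajj : A j j = 0.
  apply: (A0 x x' j j j) => //; apply/mnm_lepP => l; rewrite !mnmE.
  by case: (eqVneq j l) => [<-|_]; lia.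
have Age0 u : 0 <= A u u by rewrite AE ncoeff_ge0.
have := no_positive_plane_isotropic (hessian_sym _) (lorentzian_hessian db)
  Aii Aij Ajj (Age0 p) (Age0 q).
rewrite -/A !AE !bE !cancel -/x' => E.
by rewrite mulrC E mulrC.
Qed.

Lemma coeff_ratio x x' t t' : x \in ret_set k J -> x' \in ret_set k J ->
  t \in section_vectors k J -> t' \in section_vectors k J ->
  c (x + t)%MM / c (x + t')%MM = c (x' + t)%MM / c (x' + t')%MM.
Proof.
apply: (@rank_one_ratio _ _ (fun x t => c (x + t)%MM) _ _ (exchange_ret_set MJ)
  (exchange_section_vectors MJ)).
- exact: ret_set_mdeg MJ.
- move=> u v uT vT; have [a aM] := max_part_neq0 k MJ.
  have xR : proj k a \in ret_set k J by apply/ret_setP; exists a.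
  by rewrite (mdeg_section_vectors MJ xR uT) (mdeg_section_vectors MJ xR vT).
- by move=> y s yR sT; rewrite gt_eqF // ncoeff_gt0_product.
- by move=> y s i j p q yR nij yj y'R sT _ sq _; apply: adjacent_minor.
Qed.

(** By [coeff_ratio] the quotient of [c (y + s)] by [c (y + t)] is the same for
    all [y]; summing over [s] gives the constant [K]. *)
Lemma ncoeff_ret_section x t : x \in ret_set k J -> t \in section_vectors k J ->
  exists2 K : R, 0 < K & forall y, ncoeff (ret k f) y =
    if y \in ret_set k J then K * c (y + t)%MM else 0.
Proof.
move=> xR tT.
exists (\sum_(s <- section_vectors k J) c (x + s)%MM / c (x + t)%MM).
  rewrite (big_fsetD1 t) //= ltr_wpDr ?divr_gt0 ?ncoeff_gt0_product //.
  rewrite big_seq sumr_ge0 // => s.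
  by rewrite !inE => /andP[_ sT]; rewrite ltW // divr_gt0 ?ncoeff_gt0_product.
move=> y; rewrite ncoeff_ret; case: ifP => // yR.
rewrite mulr_suml big_seq [RHS]big_seq; apply: eq_bigr => s sT.
by rewrite (coeff_ratio xR yR sT tT) divfK // gt_eqF // ncoeff_gt0_product.
Qed.

Lemma lorentzian_ret : lorentzian (ret k f).
Proof.
have [a0 a0M] := max_part_neq0 k MJ.
have xR : proj k a0 \in ret_set k J by apply/ret_setP; exists a0.
have tT : (a0 - proj k a0)%MM \in section_vectors k J.
  by apply/section_vectorsP; exists a0.
move: (proj k a0) xR (a0 - proj k a0)%MM tT => x xR t tT.
have [K K0 cE] := ncoeff_ret_section xR tT.
have ge0 y : 0 <= (ret k f)@_y.
  have := mfact_neq0 R y; rewrite -(pmulr_rge0 _ (x := (mfact y)%:R)).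
    move=> _; rewrite -/(ncoeff _ y) cE; case: ifP => // _.
    by rewrite mulr_ge0 ?ncoeff_ge0 ?(ltW K0).
  by rewrite lt_neqAle eq_sym mfact_neq0 ler0n.
have supp_ret : supp (ret k f) = ret_set k J.
  apply/fsetP => y; rewrite -ncoeff_gt0 // cE.
  case: ifP => yR; last by rewrite ltxx.
  by rewrite mulr_gt0 // ncoeff_gt0_product.
exists (mdeg x); split=> //.
- apply/dhomogP => y; rewrite mcoeff_msupp -in_supp supp_ret => yR.
  exact: (ret_set_mdeg MJ yR xR).
- move=> _; apply: contraTneq xR => f0.
  by rewrite -supp_ret in_supp f0 mcoeff0 eqxx.
move=> m2; rewrite supp_ret; split; first exact: (M_convex_ret_set MJ).
move=> b db; apply/(at_most_one_pos_eigenvalueP (hessian_sym _)).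
have dbt : (mdeg (b + t) + 2)%N = r.
  have [_ dJ _] := MJ; rewrite -(dJ (x + t)%MM); last first.
    by rewrite -ncoeff_gt0 //; apply: ncoeff_gt0_product.
  by rewrite !mdegD db; lia.
(* The condition [b + e_i + e_j <= k] splits into conditions on [i] and on [j],
   except on the diagonal, where two units must fit. *)
have := @no_positive_plane_truncate _ _ _
  (fun i => [forall l, b l <= k l]%N && (b i < k i)%N)
  (fun i => (b i).+1 < k i)%N
  (hessian_sym _) _ (lorentzian_hessian dbt).
set T := (X in map_mx _ X) => npp.
have -> : hessian (ret k f)^`M[b] = K *: T.
  rewrite hessian_ncoeff; apply/matrixP => i j.
  rewrite mxE cE [RHS]mxE /T mxE hessian_ncoeff mxE.
  have -> : (b + t + U_(i) + U_(j) = b + U_(i) + U_(j) + t)%MM.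
    by apply/mnmP => l; rewrite !mnmE; lia.
  case: ifPn => [zR|zNR].
    rewrite ifT //; have le l := ret_set_le l zR.
    have bk : [forall l, b l <= k l]%N.
      by apply/forallP => l; have := le l; rewrite !mnmE; lia.
    rewrite bk /=; have := le i; have := le j; rewrite !mnmE !eqxx.
    by rewrite [j == i]eq_sym; case: (eqVneq i j) => [->|_] /=; lia.
  case: ifP => [/and3P[/andP[/forallP bk bi] /andP[_ bj] bij]|_]; last first.
    by rewrite mulr0.
  rewrite ncoeff_eq0 ?mulr0 //.
  apply: contra zNR => zJ; apply: (ret_set_charac MJ xR tT) => //.
    by rewrite !mdegD !mdeg1 db; lia.
  move=> l; have := bk l; rewrite !mnmE.
  move: bi bj bij; case: (eqVneq i l) => [<-|_]; case: (eqVneq j _) => [E|_];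
    try subst j; rewrite ?eqxx /=; lia.
have -> : map_mx (real_complex R) (K *: T) =
    real_complex R K *: map_mx (real_complex R) T by rewrite map_mxZ.
apply: no_positive_planeZ; first by rewrite ltcR.
by apply: npp => i; rewrite hessian_ncoeff mxE ncoeff_ge0.
Qed.

End Lorentzian.

Theorem corollary6p10 (R : realType) (n r : nat) (f : {mpoly R[n]})
    (kappa : 'X_{1..n}) (hf : lorentzian_deg r f) :
  lorentzian (ret kappa f).
Proof. exact: (lorentzian_ret kappa hf). Qed.
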